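(* Fix $n\ge 1$ and a conservative pseudo-adder on $n$-bit inputs satisfying the standing assumption. Let $\mathrm{Er}(a,b)=|s(a,b)-s'(a,b)|$ and let $\mathrm{Er}_{\mathrm{avg}}=\frac{1}{2^{2n}}\sum_{a,b}\mathrm{Er}(a,b)$, where the sum is over all pairs $(a,b)$ with $a,b\in\{0,\dots,2^n-1\}$. Then $$\mathrm{Er}_{\mathrm{avg}}=\frac{1}{2^{2n}}\sum_{C}\mathrm{EC}(C)\cdot\bigl(\nu^{+}(C)-\nu^{-}(C)\bigr),$$ where $C$ ranges over all $n(n+1)/2$ carry chains ($i$-$j$ carry chains with $1\le i\le j\le n$).
   Context: Inputs: integers $a,b\in\{0,\dots,2^n-1\}$ with binary digits $a_k,b_k$ for $0\le k\le n$, so $a_n=b_n=0$. True carries and sum bits: $c_0=0$, $c_k=a_{k-1}b_{k-1}\lor a_{k-1}c_{k-1}\lor b_{k-1}c_{k-1}$ for $1\le k\le n$, and $s_k=a_k\oplus b_k\oplus c_k$ for $0\le k\le n$; so $s(a,b)=\sum_{k=0}^n s_k2^k=a+b$. Carry chains: for $1\le i\le j\le n$, the pair $(a,b)$ generates the $i$-$j$ carry chain if $a_{i-1}=b_{i-1}=1$, $a_k\ne b_k$ for $i\le k\le j-1$, and $a_j=b_j$. A carry chain is identified with the pair $(i,j)$. $\mathcal C(a,b)$ denotes the set of carry chains generated by $(a,b)$. Pseudo-adder: functions $c'_k=c'_k(a,b)\in\{0,1\}$ for $0\le k\le n$, where $c'_0=0$ and, for $k\ge1$, $c'_k$ depends only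 on $a_{k-1},\dots,a_0$ and $b_{k-1},\dots,b_0$. Its computed sum is $s'(a,b)=\sum_{k=0}^n s'_k2^k$ with $s'_k=a_k\oplus b_k\oplus c'_k$. It is conservative if $c'_k(a,b)\le c_k(a,b)$ for all $k$ and all $(a,b)$. Standing assumption: whenever $(a,b)$ generates the $i$-$j$ carry chain and $i\le k\le j$, the value $c'_k(a,b)$ does not depend on the bits of $a,b$ in positions lower than $i-1$, nor on which pair $(a,b)$ generating the chain is considered. Error of a chain: for an $i$-$j$ carry chain $C$ and any $(a,b)$ generating it, let $(a^C,b^C)$ agree with $(a,b)$ in positions $i-1,\dots,j-1$ and have all other bits $0$. Then $\mathrm{EC}(C)=s(a^C,b^C)-s'(a^C,b^C)$, which by the standing assumption is independent of the choice of $(a,b)$. $C$ is error-contributing if $\mathrm{EC}(C)\ne0$. Dominating chain: if $\mathcal C(a,b)$ contains an error-contributing chain, $C_{\mathrm L}(a,b)$ is the leftmost one (occupying the highest positions). Set $\widehat{\mathrm{sgn}}(a,b)=\mathrm{sgn}(\mathrm{EC}(C_{\mathrm L}(a,b)))$ in that case, and $\widehat{\mathrm{sgn}}(a,b)=0$ if $\mathcal C(a,b)$ contains no error-contributing chain (in particular if it is empty). $\nu^{+}(C)$, respectively $\nu^{-}(C)$, is the number of pairs $(a,b)$ with $C\in\mathcal C(a,b)$ and $\widehat{\mathrm{sgn}}(a,b)=+1$, respectively $-1$. *)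

(* Defs.v *)
From mathcomp Require Import all_boot all_order all_algebra.

Set Implicit Arguments.
Unset Strict Implicit.
Unset Printing Implicit Defensive.

Import Order.TTheory GRing.Theory Num.Theory.

Local Open Scope nat_scope.

(* For m < 2 ^ n this is [false] at every position k >= n. *)
Definition bit (m k : nat) : bool := odd (m %/ 2 ^ k).

Fixpoint carry (a b k : nat) : bool :=
  if k is l.+1 then
    [|| bit a l && bit b l, bit a l && carry a b l | bit b l && carry a b l]
  else false.

Definition sum_bit (a b k : nat) : bool := bit a k (+) bit b k (+) carry a b k.

Definition true_sum (n a b : nat) : nat :=
  \sum_(k < n.+1) sum_bit a b k * 2 ^ k.

Record pseudo_adder (n : nat) := PseudoAdder {
  pcarry :> 'I_n.+1 -> 'I_(2 ^ n) -> 'I_(2 ^ n) -> bool;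
  pcarry0 : forall a b, pcarry ord0 a b = false;
  pcarry_local : forall (k : 'I_n.+1) (a b a' b' : 'I_(2 ^ n)), 0 < k ->
    (forall l, l < k -> bit a l = bit a' l /\ bit b l = bit b' l) ->
    pcarry k a b = pcarry k a' b'
}.

(* The pair (i, j) stands for the i-j carry chain; both indices are <= n. *)
Definition chain_index (n : nat) : finType := ('I_n.+1 * 'I_n.+1)%type.

Definition is_chain n (C : chain_index n) : bool := 1 <= C.1 <= C.2.

Definition generates n (a b : 'I_(2 ^ n)) (C : chain_index n) : bool :=
  [&& is_chain C,
      bit a C.1.-1, bit b C.1.-1,
      [forall k : 'I_n.+1, (C.1 <= k < C.2) ==> (bit a k != bit b k)]
    & bit a C.2 == bit b C.2].

Definition chains n (a b : 'I_(2 ^ n)) : {set chain_index n} :=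
  [set C | generates a b C].

Fact restrict_subproof n (a : 'I_(2 ^ n)) (C : chain_index n) :
  \sum_(k < n | C.1.-1 <= k < C.2) bit a k * 2 ^ k < 2 ^ n.
Proof.
apply: (@leq_ltn_trans (2 ^ n).-1); last by rewrite prednK // expn_gt0.
rewrite predn_exp mul1n big_mkcond /=; apply: leq_sum => k _.
by case: ifP => // _; case: (bit a k); rewrite ?mul1n.
Qed.

Definition restrict n (a : 'I_(2 ^ n)) (C : chain_index n) : 'I_(2 ^ n) :=
  Ordinal (restrict_subproof a C).

Section PseudoAdder.

Variables (n : nat) (c : pseudo_adder n).
Implicit Types (a b : 'I_(2 ^ n)) (C : chain_index n).

Definition psum_bit a b (k : 'I_n.+1) : bool := bit a k (+) bit b k (+) c k a b.

Definition pseudo_sum a b : nat := \sum_(k < n.+1) psum_bit a b k * 2 ^ k.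

Definition conservative : Prop :=
  forall (k : 'I_n.+1) a b, c k a b ==> carry a b k.

(* Changing the bits below position i - 1 of a pair generating the i-j chain
   yields another pair generating it, so independence of the generating pair
   covers independence of these lower bits. *)
Definition chain_determined : Prop :=
  forall C a b a' b', generates a b C -> generates a' b' C ->
  forall k : 'I_n.+1, C.1 <= k <= C.2 -> c k a b = c k a' b'.

Definition signed_error a b : int :=
  ((true_sum n a b)%:Z - (pseudo_sum a b)%:Z)%R.

(* The error of C is read off an arbitrary generating pair: every carry chain
   has one, and for a conservative, chain-determined pseudo-adder the value does
   not depend on which one is picked.  The value 0 is only used when [C] is not
   a carry chain. *)
Definition EC C : int :=
  if [pick p : 'I_(2 ^ n) * 'I_(2 ^ n) | generates p.1 p.2 C] is Some p
  then signed_error (restrict p.1 C) (restrict p.2 C) else 0%R.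

Definition error_contributing C : bool := EC C != 0%R.

(* Distinct chains generated by the same pair occupy disjoint blocks of
   positions i, ..., j, so at most one chain meets the condition. *)
Definition dominating a b : option (chain_index n) :=
  [pick C in chains a b | error_contributing C &
    [forall C' in chains a b, error_contributing C' ==> (C'.2 <= C.2)]].

Definition sgn_hat a b : int :=
  if dominating a b is Some C then Num.sg (EC C) else 0%R.

Definition nu (e : int) C : nat :=
  #|[set p : 'I_(2 ^ n) * 'I_(2 ^ n) |
      (C \in chains p.1 p.2) && (sgn_hat p.1 p.2 == e)]|.

Definition nu_pos : chain_index n -> nat := nu 1%R.
Definition nu_neg : chain_index n -> nat := nu (-1)%R.

Definition Er a b : int := `|signed_error a b|%R.

Definition Er_avg : rat :=
  ((2 ^ (2 * n))%:R^-1 *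
   \sum_(a < 2 ^ n) \sum_(b < 2 ^ n) (Er a b)%:~R)%R.

End PseudoAdder.

(* Main.v *)
(* A true carry occurs at position k exactly when a (necessarily
   unique) chain of (a, b) covers k; elsewhere a conservative pseudo-adder makes
   no error.  So s - s' is the sum of EC over the chains of (a, b).  Let L be the
   dominating i-j chain.  EC L is a nonzero multiple of 2 ^ i, whereas the other
   error-contributing chains lie in positions below i, where the errors have
   digits in {-1, 0, 1} and thus sum to less than 2 ^ i in absolute value.  Hence
   |s - s'| is the sign of EC L times the sum of EC over the chains; summing over
   (a, b) and exchanging the two sums gives the formula. *)
Require Import Defs.
From mathcomp Require Import all_boot all_order all_algebra.
From mathcomp Require Import zify ring.

Set Implicit Arguments.
Unset Strict Implicit.
Unset Printing Implicit Defensive.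

Import Order.TTheory GRing.Theory Num.Theory.

Local Open Scope ring_scope.

(** * Binary digits and geometric sums *)

Lemma bit_sum (f : nat -> bool) n m :
  bit (\sum_(k < n) f k * 2 ^ k) m = (m < n)%N && f m.
Proof.
elim: n f m => [|n IH] f m; first by rewrite big_ord0 /bit div0n.
have -> : (\sum_(k < n.+1) f k * 2 ^ k =
           f 0 + (\sum_(k < n) f k.+1 * 2 ^ k) * 2)%N.
  rewrite big_ord_recl muln1 big_distrl /=; congr (_ + _)%N.
  by apply: eq_bigr => k _; rewrite expnSr mulnA.
case: m => [|m]; rewrite /bit.
  by rewrite divn1 oddD oddM andbF addbF oddb.
rewrite expnS divnMA addnC divnMDl // [(f 0 %/ 2)%N]divn_small ?addn0; last by case: (f 0).
exact: (IH (fun k => f k.+1)).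
Qed.

Lemma bit_large n m k : (m < 2 ^ n)%N -> (n <= k)%N -> bit m k = false.
Proof.
move=> mn nk; rewrite /bit divn_small //.
by apply: leq_trans mn _; rewrite leq_exp2l.
Qed.

Lemma bit_restrict n (a : 'I_(2 ^ n)) (C : chain_index n) k :
  bit (restrict a C) k = (C.1.-1 <= k < C.2)%N && bit a k.
Proof.
rewrite /= big_mkcond /=.
rewrite (eq_bigr (fun l : 'I_n =>
    ((C.1.-1 <= l < C.2)%N && bit a l) * 2 ^ l)%N); last first.
  by move=> l _; case: ifP.
rewrite (bit_sum (fun l => (C.1.-1 <= l < C.2)%N && bit a l)).
have [//|nk] := ltnP k n.
by rewrite (bit_large (ltn_ord a) nk) andbF.
Qed.

(** Bounds a total error whose digits lie in {-1, 0, 1} and sit below position [m]. *)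
Lemma sum_expr2_lt N m : \sum_(k < N | (k < m)%N) 2 ^+ k < 2 ^+ m :> int.
Proof.
suff -> : \sum_(k < N | (k < m)%N) 2 ^+ k = 2 ^+ minn N m - 1 :> int.
  by rewrite ltrBlDr ltzD1 ler_weXn2l // geq_minr.
elim: N => [|N IH]; first by rewrite big_ord0 min0n subrr.
rewrite big_mkcond big_ord_recr -big_mkcond /= IH.
have [lt|ge] := ltnP N m.
  by rewrite (minn_idPl lt) exprS; ring.
by rewrite addr0 (minn_idPr (leqW ge)).
Qed.

(** * Carries and the chains that produce them *)

Lemma carryS_eq a b k : bit a k = bit b k -> carry a b k.+1 = bit a k.
Proof. by move=> /= <-; case: (bit a k) => /=; case: (carry a b k). Qed.

Lemma carryS_neq a b k : bit a k != bit b k -> carry a b k.+1 = carry a b k.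
Proof. by move=> /=; case: (bit a k); case: (bit b k) => //=; case: (carry a b k). Qed.

(** Going down from [k], a carry passes unchanged through positions with different bits; the first
    position with equal bits decides it, so both bits there are 1. *)
Lemma carry_start a b k : carry a b k ->
  exists i, [/\ (1 <= i <= k)%N, bit a i.-1, bit b i.-1 &
    forall m, (i <= m < k)%N -> bit a m != bit b m].
Proof.
elim: k => [//|k IH]; have [e|ne] := eqVneq (bit a k) (bit b k).
  rewrite (carryS_eq e) => ak; exists k.+1.
  by split=> //=; [rewrite -e | move=> m; lia].
rewrite (carryS_neq ne) => /IH[i [ik ai bi prop]]; exists i; split=> //; first lia.
by move=> m im; have [->//|mk] := eqVneq m k; apply: prop; lia.
Qed.

Lemma generatesP n (a b : 'I_(2 ^ n)) (C : chain_index n) :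
  reflect [/\ is_chain C, bit a C.1.-1, bit b C.1.-1,
     forall m, (C.1 <= m < C.2)%N -> bit a m != bit b m
   & bit a C.2 = bit b C.2] (generates a b C).
Proof.
apply: (iffP and5P) => -[-> -> -> prop e]; split=> //; last by apply/eqP.
- move=> m mC; have lt : (m < n.+1)%N by have := ltn_ord C.2; lia.
  by have /forallP/(_ (Ordinal lt))/implyP := prop; apply.
- exact/eqP.
- by apply/forallP => k; apply/implyP => /prop.
Qed.

(** The block starts at [C.1], not [C.1.-1]: it collects the positions that receive the carry, and
    these include the end [C.2]. *)
Definition covers n (C : chain_index n) (k : nat) := (C.1 <= k <= C.2)%N.

Lemma carry_chain n (a b : 'I_(2 ^ n)) k : (k <= n)%N -> carry a b k ->
  exists2 C, generates a b C & covers C k.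
Proof.
move=> kn /carry_start[i [ik ai bi prop]].
(* Position [n] is a witness, since both inputs have bit 0 there; the least such [j] ends the
   chain. *)
have exj : exists j, (k <= j)%N && (bit a j == bit b j).
  by exists n; rewrite kn !(bit_large (ltn_ord _) (leqnn n)) eqxx.
case: (ex_minnP exj) => j /andP[kj /eqP ej] minj.
have jn : (j <= n)%N.
  by apply: minj; rewrite kn !(bit_large (ltn_ord _) (leqnn n)) eqxx.
have lti : (i < n.+1)%N by lia.
have ltj : (j < n.+1)%N by lia.
exists (Ordinal lti, Ordinal ltj); last by rewrite /covers /=; lia.
apply/generatesP; split=> //=; first by rewrite /is_chain /=; lia.
move=> m /andP[im mj]; have [mk|km] := ltnP m k; first by apply: prop; lia.
by apply/negP => em; have := minj m; rewrite km em => /(_ isT); lia.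
Qed.

Lemma chain_carry n (a b : 'I_(2 ^ n)) (C : chain_index n) k :
  generates a b C -> covers C k -> carry a b k.
Proof.
case/generatesP=> /andP[C1 _] aC bC prop _ /andP[].
move/subnK => <-; elim: (k - C.1)%N => [|m IH] mC.
  by rewrite add0n -(prednK C1) carryS_eq ?aC ?bC.
by rewrite addSn carryS_neq; [apply: IH|apply: prop]; lia.
Qed.

(** If one chain started later, its generating position, with equal bits, would lie where the other
    propagates; if one ended earlier, its end would. *)
Lemma covers_uniq n (a b : 'I_(2 ^ n)) (C C' : chain_index n) k :
  generates a b C -> generates a b C' -> covers C k -> covers C' k -> C = C'.
Proof.
have le1 (D D' : chain_index n) : generates a b D -> generates a b D' ->
    covers D k -> covers D' k -> (D'.1 <= D.1)%N.
  case/generatesP=> _ _ _ prop _ /generatesP[_ aD bD _ _] /andP[? ?] /andP[? ?].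
  by rewrite leqNgt; apply/negP => lt; have := prop D'.1.-1; rewrite aD bD; lia.
have le2 (D D' : chain_index n) : generates a b D -> generates a b D' ->
    covers D k -> covers D' k -> (D'.2 <= D.2)%N.
  case/generatesP=> _ _ _ _ e /generatesP[_ _ _ prop _] /andP[? ?] /andP[? ?].
  by rewrite leqNgt; apply/negP => lt; have := prop D.2; rewrite e eqxx; lia.
move=> gC gC' kC kC'; rewrite (surjective_pairing C) (surjective_pairing C').
by congr (_, _); apply/val_inj/eqP; rewrite eqn_leq ?le1 ?le2.
Qed.

(** * Errors of digits and of chains *)

Section PseudoAdderError.

Variables (n : nat) (c : pseudo_adder n).
Hypotheses (hcons : conservative c) (hdet : chain_determined c).
Implicit Types (a b : 'I_(2 ^ n)) (C : chain_index n).

Definition digit_error a b (k : 'I_n.+1) : int :=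
  (sum_bit a b k : nat)%:Z - (psum_bit c a b k : nat)%:Z.

(** Evaluated on the unrestricted pair, so that [signed_error] splits into these terms directly;
    [EC_chain_error] identifies them with [EC]. *)
Definition chain_error a b C : int :=
  \sum_(k < n.+1 | covers C k) digit_error a b k * 2 ^+ k.

Lemma signed_error_digits a b :
  signed_error c a b = \sum_(k < n.+1) digit_error a b k * 2 ^+ k.
Proof.
rewrite /signed_error /true_sum /pseudo_sum !(big_morph _ PoszD (erefl _)).
rewrite -sumrB; apply: eq_bigr => k _.
by rewrite /digit_error mulrBl !PoszM -!natrX !natz.
Qed.

Lemma digit_error_nocarry a b (k : 'I_n.+1) :
  ~~ carry a b k -> digit_error a b k = 0.
Proof.
move=> nk; rewrite /digit_error /sum_bit /psum_bit.
have := hcons k a b; case: (c k a b) => /=; first by rewrite (negPf nk).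
by rewrite (negPf nk) subrr.
Qed.

Lemma norm_digit_error_le1 a b k : `|digit_error a b k| <= 1.
Proof. by rewrite /digit_error; case: sum_bit; case: psum_bit. Qed.

(** By [covers_uniq], exchanging the sums counts each digit at most once. The predicate [P] serves
    to single out the chains below the dominating one. *)
Lemma sum_chain_error a b (P : pred (chain_index n)) :
  \sum_(C | generates a b C && P C) chain_error a b C =
  \sum_(k < n.+1 | [exists C, [&& generates a b C, P C & covers C k]])
     digit_error a b k * 2 ^+ k.
Proof.
rewrite /chain_error (exchange_big_dep predT) //= [RHS]big_mkcond /=.
apply: eq_bigr => k _; case: ifP => [/existsP[C /and3P[gC PC kC]]|/existsPn none].
  rewrite (big_pred1 C) // => D /=; apply/idP/eqP => [/andP[/andP[gD _] kD]|->].
    exact: covers_uniq gD gC kD kC.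
  by rewrite gC PC.
by rewrite big_pred0 // => C; rewrite -andbA (negPf (none C)).
Qed.

Lemma signed_error_chains a b :
  signed_error c a b = \sum_(C | generates a b C) chain_error a b C.
Proof.
rewrite signed_error_digits.
rewrite [RHS](eq_bigl (fun C => generates a b C && predT C)); last first.
  by move=> C; rewrite andbT.
rewrite sum_chain_error [RHS]big_mkcond; apply: eq_bigr => k _ /=.
case: ifP => // /existsPn none; rewrite digit_error_nocarry ?mul0r //.
apply/negP => /carry_chain[|C gC kC]; first by rewrite -ltnS.
by have := none C; rewrite gC kC.
Qed.

(** The true carry is 1 on the whole block and the computed one depends on [C] only. The input bits
    enter through their exclusive or, which is 1 before [C.2] and 0 at [C.2]. *)
Lemma chain_error_indep a b a' b' C :
  generates a b C -> generates a' b' C -> chain_error a b C = chain_error a' b' C.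
Proof.
move=> gC gC'; apply: eq_bigr => k kC; congr (_ * _).
rewrite /digit_error /sum_bit /psum_bit (chain_carry gC kC) (chain_carry gC' kC).
rewrite (hdet gC gC' kC); congr ((_ (+) _ : nat)%:Z - (_ (+) _ : nat)%:Z);
case/generatesP: gC => _ _ _ prop e; case/generatesP: gC' => _ _ _ prop' e';
move: kC; rewrite /covers [(k <= _)%N]leq_eqVlt andb_orr => /orP[/andP[_ /eqP ->]|kC];
by [rewrite e e' !addbb|have := prop' _ kC; have := prop _ kC; do 4!case: bit].
Qed.

Lemma generates_restrict a b C :
  generates a b C -> generates (restrict a C) (restrict b C) C.
Proof.
case/generatesP=> /andP[C1 C2] aC bC prop e.
have inC : (C.1.-1 <= C.1.-1 < C.2)%N by lia.
apply/generatesP; split.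
- by rewrite /is_chain C1.
- by rewrite bit_restrict inC.
- by rewrite bit_restrict inC.
- move=> m mC; have mC' : (C.1.-1 <= m < C.2)%N by lia.
  by rewrite !bit_restrict mC' prop.
- by rewrite !bit_restrict ltnn andbF.
Qed.

(** A carry can only start from a bit kept by the restriction, and it dies at [C.2], where both
    restricted bits are 0. *)
Lemma carry_restrict a b C k :
  carry (restrict a C) (restrict b C) k -> covers C k.
Proof.
case/carry_start => i [ik]; rewrite !bit_restrict => /andP[iC _] _ prop.
rewrite /covers; apply/andP; split; first by lia.
rewrite leqNgt; apply/negP => lt; have := prop C.2.
by rewrite !bit_restrict ltnn andbF eqxx => H; apply: notF; apply: H; lia.
Qed.

Lemma EC_chain_error a b C : generates a b C -> EC c C = chain_error a b C.
Proof.
move=> gC; rewrite /EC; case: pickP => [[a' b'] /= gC'|/(_ (a, b))/=]; last first.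
  by rewrite gC.
rewrite (chain_error_indep gC (generates_restrict gC')) signed_error_digits.
rewrite /chain_error [RHS]big_mkcond; apply: eq_bigr => k _.
case: ifPn => // nk; rewrite digit_error_nocarry ?mul0r //.
by apply: contra nk; apply: carry_restrict.
Qed.

Lemma signed_error_EC a b :
  signed_error c a b = \sum_(C in chains a b) EC c C.
Proof.
rewrite signed_error_chains; apply: eq_big => [C|C gC]; first by rewrite inE.
by rewrite (EC_chain_error gC).
Qed.

Lemma dvdz_EC C : (2 ^+ C.1 %| EC c C)%Z.
Proof.
have [p gC|none] := pickP (fun p : 'I_(2 ^ n) * 'I_(2 ^ n) => generates p.1 p.2 C).
  rewrite (EC_chain_error gC); apply: rpred_sum => k /andP[kC _].
  by rewrite dvdz_mull // -(subnK kC) exprD dvdz_mull.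
(* Without a generating pair, [EC] takes its default value 0. *)
by rewrite /EC (eq_pick none); case: pickP.
Qed.

Lemma norm_lower_chains_lt a b (P : pred (chain_index n)) m :
  (forall C, generates a b C -> P C -> (C.2 < m)%N) ->
  `|\sum_(C in chains a b | P C) EC c C| < 2 ^+ m.
Proof.
move=> Pm.
rewrite (eq_big (fun C => generates a b C && P C) (chain_error a b)); first last.
- by move=> C /andP[]; rewrite inE => /EC_chain_error.
- by move=> C; rewrite inE.
rewrite sum_chain_error; apply: le_lt_trans (ler_norm_sum _ _ _) _.
have sub (k : 'I_n.+1) :
    [exists C, [&& generates a b C, P C & covers C k]] -> (k < m)%N.
  by case/existsP=> C /and3P[gC /(Pm _ gC) ? /andP[_ ?]]; lia.
apply: le_lt_trans (sum_expr2_lt n.+1 m).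
rewrite big_mkcond [leRHS]big_mkcond; apply: ler_sum => k _.
case: ifP => [/sub ->|_]; last by case: ifP => // _; rewrite exprn_ge0.
by rewrite normrM [X in _ * X]ger0_norm ?exprn_ge0 // ler_piMl ?exprn_ge0 ?norm_digit_error_le1.
Qed.

(** * The dominating chain fixes the sign of the error *)

Lemma dominatingP a b C : dominating c a b = Some C ->
  [/\ generates a b C, EC c C != 0 &
   forall C', generates a b C' -> C' != C -> EC c C' != 0 -> (C'.2 < C.1)%N].
Proof.
rewrite /dominating; case: pickP => // D /and3P[]; rewrite inE => gD eD /forallP maxD.
case=> <-; split=> // C' gC' ne eC'.
have := maxD C'; rewrite inE gC' /error_contributing eC' /= => le.
rewrite ltnNge; apply: contra ne => le'; apply/eqP.
have /andP[_ ?] : is_chain C' by case/generatesP: gC'.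
(* If [C'] reached [C.1], its end [C'.2] would be covered by both chains. *)
by apply: (covers_uniq (k := C'.2) gC' gD); rewrite /covers ?leqnn ?andbT // le'.
Qed.

(** If some chain contributed, a contributing one with the largest end would have been picked. *)
Lemma dominating_None a b C : dominating c a b = None ->
  generates a b C -> EC c C = 0.
Proof.
rewrite /dominating; case: pickP => // none _ gC; apply/eqP/negPn/negP => eC.
pose P := [pred D | (D \in chains a b) && error_contributing c D].
have PC : P C by rewrite /= inE gC.
case: (@arg_maxnP _ C P (fun D => nat_of_ord D.2) PC) => D PD maxD.
move/negP: (none D); apply; rewrite andbA; apply/andP; split=> //.
by apply/forallP => C'; apply/implyP => gC'; apply/implyP => eC'; apply: maxD; rewrite /= gC'.
Qed.

Lemma Er_sgn_hat a b : Er c a b = sgn_hat c a b * \sum_(C in chains a b) EC c C.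
Proof.
rewrite /Er /sgn_hat signed_error_EC; case E: dominating => [L|]; last first.
  rewrite mul0r big1 ?normr0 // => C; rewrite inE; exact: dominating_None.
have [gL eL low] := dominatingP E.
have LL : L \in chains a b by rewrite inE.
rewrite (bigD1 L) //=.
set rest := \sum_(C in _ | _) _.
have restlt : `|rest| < 2 ^+ L.1.
  (* Chains with zero error may lie above [L]; they are dropped before the bound on lower chains is
     applied. *)
  rewrite /rest (bigID (fun C => EC c C == 0)) /= big1 ?add0r; last first.
    by move=> C /andP[_ /eqP].
  rewrite (eq_bigl (fun C => (C \in chains a b) && ((C != L) && (EC c C != 0)))).
    apply: norm_lower_chains_lt => C gC /andP[]; exact: low.
  by move=> C; rewrite andbA.
have Lge : 2 ^+ L.1 <= `|EC c L|.
  have /dvdzP[q eq] := dvdz_EC L; rewrite eq normrM normrX /= ler_peMl ?exprn_ge0 //.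
  have : q != 0 by apply: contraNneq eL => q0; rewrite eq q0 mul0r.
  lia.
(* Since [rest] is smaller in absolute value than [EC c L], adding it keeps the sign. *)
by case: sgrP Lge eL => // _; lia.
Qed.

(** Turns sums of signs into the counts [nu_pos] and [nu_neg]. *)
Lemma sgn_hat_indicators a b :
  sgn_hat c a b = (sgn_hat c a b == 1)%:R - (sgn_hat c a b == -1)%:R.
Proof. by rewrite /sgn_hat; case: dominating => [C|] //; case: sgrP. Qed.

Lemma sum_sgn_hat C :
  \sum_(p : 'I_(2 ^ n) * 'I_(2 ^ n) | C \in chains p.1 p.2) sgn_hat c p.1 p.2 =
  (nu_pos c C)%:Z - (nu_neg c C)%:Z.
Proof.
have nuE e : (nu c e C)%:Z = \sum_(p : 'I_(2 ^ n) * 'I_(2 ^ n) |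
    C \in chains p.1 p.2) (sgn_hat c p.1 p.2 == e)%:R.
  rewrite /nu cardsE -sum1_card (big_morph _ PoszD (erefl _)) big_mkcondr.
  by apply: eq_bigr => p _; case: eqP.
rewrite !nuE -sumrB; apply: eq_bigr => p _; exact: sgn_hat_indicators.
Qed.

End PseudoAdderError.

Theorem theorem2 (n : nat) (hn : (1 <= n)%N) (c : pseudo_adder n)
    (hcons : conservative c) (hdet : chain_determined c) :
  Er_avg c =
  (2 ^ (2 * n))%:R^-1 *
  \sum_(C : chain_index n | is_chain C)
     (EC c C * ((nu_pos c C)%:Z - (nu_neg c C)%:Z))%:~R.
Proof.
rewrite /Er_avg; congr (_ * _).
under eq_bigr => a _ do under eq_bigr => b _ do rewrite Er_sgn_hat // big_distrr.
rewrite pair_big /= -!rmorph_sum; congr (_%:~R).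
(* The outer index can be limited to [is_chain], which is part of [generates]. *)
rewrite (exchange_big_dep (fun C => is_chain C)) /=; last first.
  by move=> p C _; rewrite inE => /generatesP[].
by apply: eq_bigr => C _; rewrite -sum_sgn_hat mulrC big_distrl.
Qed.
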